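(* Let $\mathbf F$ be a portrait of degree $d\ge 2$ with underlying map $F:Y\to Z$ and let $X\subseteq Y\cap Z$ have at least three elements. Let $(\mathcal F_n)_n=(f_n,a_n^Y,a_n^Z)_n$ be a sequence of dynamical systems between marked spheres, i.e. a sequence in $\mathrm{Rat}_{\mathbf F,X}$, and let $(\mathcal F,\mathcal T^X)\in\mathbf{Dyn}_{\mathbf F,X}$ be a dynamical system between trees of spheres. Then $(\mathcal F_n)_n$ converges to $\mathcal F$ (in the sense of convergence of covers) if and only if $(\mathcal F_n)_n$ dynamically converges to $(\mathcal F,\mathcal T^X)$.
   Context: $\mathbb S=\mathbb P^1(\mathbb C)$. A portrait $\mathbf F$ of degree $d\ge2$ is a pair $(F,\deg)$ with $F:Y\to Z$ a map between finite sets and $\deg:Y\to\{1,\dots,d\}$ such that $\sum_{a\in Y}(\deg(a)-1)=2d-2$ and $\sum_{a\in F^{-1}(b)}\deg(a)=d$ for all $b\in Z$. A combinatorial tree marked by a finite set $X$ (at least three elements) is a finite tree $T$ whose set of leaves is $X$ and all of whose internal vertices have valence $\ge3$. A tree of spheres $\mathcal T$ marked by $X$ is such a $T$ with, for each internal vertex $v$, a Riemann sphere $\mathbb S_v$ and an injection $i_v:E_v\to\mathbb S_v$ of the set $E_v$ of edges adjacent to $v$; $X_v:=i_v(E_v)$, and $a_v:X\to\mathbb S_v$ is $a_v(x)=i_v(e)$ with $e\in E_v$ in the component of $T\setminus\{v\}$ containing $x$. A tree map sends internal vertices to internal vertices, leaves to leaves, edges to edges, adjacent vertices to adjacent vertices.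 A cover $\mathcal F:\mathcal T^Y\to\mathcal T^Z$ between trees of spheres is a tree map $F:T^Y\to T^Z$ and, for each internal vertex $v$ of $T^Y$ with $w=F(v)$, a holomorphic ramified cover $f_v:\mathbb S_v\to\mathbb S_w$ such that $f_v:\mathbb S_v-Y_v\to\mathbb S_w-Z_w$ is a cover, $f_v\circ i_v=i_w\circ F$, and for each edge $e$ between internal vertices $v,v'$ the local degree of $f_v$ at $i_v(e)$ equals that of $f_{v'}$ at $i_{v'}(e)$. Its portrait is $(F|_Y,\deg|_Y)$, where $\deg(y)$ is the local degree of $f_v$ at $i_v(\{v,y\})$, $v$ being the internal vertex adjacent to $y\in Y$. $\mathbf{Dyn}_{\mathbf F,X}$ is the set of dynamical systems between trees of spheres of portrait $\mathbf F$: pairs $(\mathcal F,\mathcal T^X)$ with $\mathcal F:\mathcal T^Y\to\mathcal T^Z$ a cover of portrait $\mathbf F$ and $\mathcal T^X$ a tree of spheres marked by $X$ such that every internal vertex $v$ of $T^X$ is an internal vertex of both $T^Y$ and $T^Z$, $\mathbb S^X_v=\mathbb S^Y_v=\mathbb S^Z_v$ and $a^X_v=a^Y_v|_X=a^Z_v|_X$. $\mathrm{Rat}_{\mathbf F,X}$ is the set of triples $(f,y,z)$ with $f:\mathbb S\to\mathbb S$ rational of degree $d$, $y:Y\to\mathbb S$ and $z:Z\to\mathbb S$ injections, $f\circ y=z\circ F$, $\deg_{y(a)}f=\deg(a)$ for $a\in Y$, and $y|_X=z|_X$. Convergence of covers: $(f_n,a_n^Y,a_n^Z)$ converges to $\mathcal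 F:\mathcal T^Y\to\mathcal T^Z$ with respect to $(\phi_n^Y,\phi_n^Z)$ if for all internal vertices $v$ of $T^Y$ and $w=F(v)$ there are sequences of isomorphisms $\phi^Y_{n,v}:\mathbb S\to\mathbb S_v$ and $\phi^Z_{n,w}:\mathbb S\to\mathbb S_w$ such that $\phi^Y_{n,v}\circ a_n^Y\to a_v^Y$, $\phi^Z_{n,w}\circ a_n^Z\to a_w^Z$, and $\phi^Z_{n,w}\circ f_n\circ(\phi^Y_{n,v})^{-1}\to f_v$ locally uniformly outside $Y_v$. Dynamical convergence to $(\mathcal F,\mathcal T^X)$: convergence to $\mathcal F$ with respect to some $(\phi_n^Y,\phi_n^Z)$ satisfying $\phi^Y_{n,v}=\phi^Z_{n,v}$ for every internal vertex $v$ of $T^X$. *)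

(* Defs.v *)
From HB Require Import structures.
From mathcomp Require Import all_boot all_order all_algebra.
From mathcomp Require Import complex ring lra.
From mathcomp Require Import all_classical all_reals all_analysis.
Set Implicit Arguments.
Unset Strict Implicit.
Unset Printing Implicit Defensive.
Import Order.TTheory GRing.Theory Num.Theory.
Import numFieldNormedType.Exports.
Local Open Scope classical_set_scope.
Local Open Scope ring_scope.

(* The regular algebra (complex R)^o carries the norm topology and complex
   differentiability; None is the point at infinity. *)
Notation P1 R := (one_point_compactification (complex R)^o).

Section Mobius.
Context {R : realType}.
Implicit Types a b c d : R[i].

(* The point with homogeneous coordinates [n : m]. *)
Definition proj_point (n m : R[i]) : P1 R :=
  if m == 0 then None else Some (n / m).

Definition mobius_map a b c d (p : P1 R) : P1 R :=
  if p is Some z then proj_point (a * z + b) (c * z + d) else proj_point a c.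

Definition mobius : set (P1 R -> P1 R) :=
  [set f | exists a b c d, a * d - b * c != 0 /\ f = mobius_map a b c d].

Lemma mobius_map_proj a b c d n m : ~~ ((n == 0) && (m == 0)) ->
  mobius_map a b c d (proj_point n m) =
  proj_point (a * n + b * m) (c * n + d * m).
Proof.
rewrite negb_and /proj_point => nm0.
have [m0|m0] /= := eqVneq m 0.
  rewrite m0 !mulr0 !addr0 /proj_point.
  have n0 : n != 0 by move: nm0; rewrite m0 eqxx orbF.
  rewrite mulf_eq0 (negbTE n0) orbF; case: eqP => // c0.
  by rewrite -mulf_div divff ?mulr1.
rewrite /proj_point.
have -> : c * (n / m) + d = (c * n + d * m) / m by field.
have -> : a * (n / m) + b = (a * n + b * m) / m by field.
rewrite mulf_eq0 invr_eq0 (negbTE m0) orbF; case: eqP => // /eqP cd0.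
by congr Some; field; rewrite m0 cd0.
Qed.

Lemma mobius_mapM a b c d a' b' c' d' : a' * d' - b' * c' != 0 ->
  mobius_map a b c d \o mobius_map a' b' c' d' =
  mobius_map (a * a' + b * c') (a * b' + b * d')
             (c * a' + d * c') (c * b' + d * d').
Proof.
move=> D; apply/funext => -[z|] /=.
  rewrite mobius_map_proj; first by congr proj_point; ring.
  apply: contra D => /andP[/eqP e1 /eqP e2].
  have [c0|c0] := eqVneq c' 0.
    move: e2; rewrite c0 mul0r add0r => ->; by rewrite !mulr0 subr0.
  have -> : a' * d' - b' * c' = a' * (c' * z + d') - c' * (a' * z + b') by ring.
  by rewrite e1 e2 !mulr0 subr0.
rewrite mobius_map_proj //.
by apply: contra D => /andP[/eqP -> /eqP ->]; rewrite mul0r mulr0 subr0.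
Qed.

Lemma mobius_comp (f g : P1 R -> P1 R) : mobius f -> mobius g -> mobius (f \o g).
Proof.
move=> [a [b [c [d [D ->]]]]] [a' [b' [c' [d' [D' ->]]]]].
rewrite mobius_mapM//; do 4 eexists; split; last reflexivity.
have -> : (a * a' + b * c') * (c * b' + d * d') -
  (a * b' + b * d') * (c * a' + d * c') = (a * d - b * c) * (a' * d' - b' * c').
  by ring.
by rewrite mulf_neq0.
Qed.

Lemma mobius_mapZ k : k != 0 -> mobius_map k 0 0 k = id.
Proof.
move=> k0; apply/funext => -[z|] /=; rewrite /proj_point ?eqxx//.
by rewrite mul0r add0r (negbTE k0) addr0 mulrC mulKf.
Qed.

Lemma mobius_id : mobius id.
Proof.
exists 1, 0, 0, 1; split; first by rewrite mulr1 mulr0 subr0 oner_neq0.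
by rewrite mobius_mapZ ?oner_neq0.
Qed.

Lemma mobius_inv (f : P1 R -> P1 R) : mobius f ->
  exists g, [/\ mobius g, cancel f g & cancel g f].
Proof.
move=> [a [b [c [d [D ->]]]]].
have D' : d * a - (- b) * (- c) != 0 by rewrite mulrNN (mulrC d).
exists (mobius_map d (- b) (- c) a); split; first by exists d, (- b), (- c), a.
- apply/funeqP; rewrite -/(_ \o _) mobius_mapM//.
  rewrite -[RHS](mobius_mapZ D); congr mobius_map; ring.
- apply/funeqP; rewrite -/(_ \o _) mobius_mapM//.
  rewrite -[RHS](mobius_mapZ D); congr mobius_map; ring.
Qed.

Local Notation C := (R[i])^o.

Lemma normCE (z : R[i]) : `|z| = (Normc.normc z)%:C%C.
Proof. by []. Qed.

Lemma nbhsCP (x : C) (A : set C) :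
  nbhs x A <-> exists2 e : R, 0 < e & forall y, Normc.normc ((y : R[i]) - (x : R[i])) < e -> A y.
Proof.
split=> [/nbhs_ballP[e/= e0 eA]|[e e0 eA]].
  have eE : e = (complex.Re e)%:C%C.
    by move: e0; case: (e) => a b; rewrite ltcE /= => /andP[/eqP -> _].
  exists (complex.Re e); first by rewrite -ltcR -eE.
  move=> y xy; apply: eA; rewrite -ball_normE /= distrC normCE eE.
  by rewrite ltcR.
apply/nbhs_ballP; exists e%:C%C => /=; first by rewrite ltcR.
by move=> y; rewrite -ball_normE /= distrC normCE ltcR => /eA.
Qed.

Lemma normc_ge0 (z : R[i]) : 0 <= Normc.normc z.
Proof. by case: z => a b; exact: sqrtr_ge0. Qed.

Lemma normc_triangle (x y : R[i]) :
  Normc.normc (x + y) <= Normc.normc x + Normc.normc y.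
Proof. by rewrite -lecR rmorphD /=; exact: (@ler_normD _ R[i]). Qed.

Lemma normc_opp (x : R[i]) : Normc.normc (- x) = Normc.normc x.
Proof. by apply: complexI; exact: (@normrN _ R[i]). Qed.

Lemma normc_ltD (x y : R[i]) : `|Normc.normc x - Normc.normc y| <= Normc.normc (y - x).
Proof.
rewrite ler_norml; apply/andP; split.
  rewrite lerBrDl lerBlDr addrC.
  by rewrite (le_trans _ (normc_triangle _ _)) // subrK.
rewrite lerBlDl -(normc_opp (y - x)) opprB.
by rewrite (le_trans _ (normc_triangle _ _)) // addrC subrK.
Qed.

Lemma normc_continuous : continuous (@Normc.normc R : C -> R).
Proof.
move=> x A /nbhs_ballP[e /= e0 eA]; apply/nbhsCP; exists e => // y xy.
by apply: eA; apply: le_lt_trans xy; exact: normc_ltD.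
Qed.

Lemma compactC_bounded (K : set C) : compact K ->
  exists2 M : R, 0 < M & forall z, K z -> Normc.normc z <= M.
Proof.
move=> cK.
have : compact (@Normc.normc R @` K : set R).
  apply: continuous_compact => //.
  by apply: continuous_subspaceT => x; exact: normc_continuous.
move=> /compact_bounded[M [Mr MK]].
exists (`|M| + 1); first by rewrite ltr_wpDl.
move=> z Kz; apply: le_trans (ler_norm _) (MK _ _ _ _); last by exists z.
by rewrite (le_lt_trans (ler_norm _)) // ltrDl.
Qed.

Lemma closed_normc_le (M : R) : closed [set z : C | Normc.normc z <= M].
Proof.
apply: (@preimage_closed _ _ (@Normc.normc R : C -> R) [set x | x <= M]).
  by move=> x _; exact: normc_continuous.
exact: closed_le.
Qed.

Lemma compact_normc_le (M : R) : compact [set z : C | Normc.normc z <= M].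
Proof.
pose h (ab : R * R) : C := (ab.1 +i* ab.2)%C.
have hc : continuous h.
  move=> [a b] A /nbhsCP[e e0 eA].
  have e2 : 0 < e / 2 by rewrite divr_gt0.
  have Nfst : \forall x \near ((a, b) : R * R), `|a - x.1| < e / 2.
    by apply: cvg_fst (ball a (e / 2)) _; exact: nbhsx_ballx.
  have Nsnd : \forall x \near ((a, b) : R * R), `|b - x.2| < e / 2.
    by apply: cvg_snd (ball b (e / 2)) _; exact: nbhsx_ballx.
  suff : \forall x \near ((a, b) : R * R), A (h x) by [].
  near=> x; apply: eA; rewrite /h.
  have -> : (x.1 +i* x.2 - ((a, b).1 +i* (a, b).2) =
             (x.1 - a)%:C + 'i * (x.2 - b)%:C)%C.
    by simpc.
  apply: le_lt_trans (normc_triangle _ _) _.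
  rewrite Normc.normcM /= expr0n/= expr1n add0r sqrtr1 mul1r !addr0 !sqrtr_sqr.
  rewrite [ltRHS]splitr ltrD //.
    rewrite distrC; near: x; exact: Nfst.
  rewrite distrC; near: x; exact: Nsnd.
apply: (subclosed_compact (B := h @` (`[-M, M] `*` `[-M, M]))).
- exact: closed_normc_le.
- apply: continuous_compact; first exact: continuous_subspaceT.
  by apply: compact_setX; exact: segment_compact.
- case=> a b /= ab; exists (a, b) => //; split; rewrite /= in_itv /= -ler_norml;
    apply: le_trans ab; rewrite -sqrtr_sqr ler_wsqrtr //.
    by rewrite lerDl sqr_ge0.
  by rewrite lerDr sqr_ge0.
Unshelve. all: by end_near.
Qed.

Let inversion : P1 R -> P1 R := mobius_map 0 1 1 0.

Let inversionE z : inversion (Some z) = if z == 0 then None else Some z^-1.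
Proof. by rewrite /inversion /= /proj_point mul0r mul1r add0r addr0 div1r. Qed.

Let inversionN : inversion None = Some 0.
Proof. by rewrite /inversion /= /proj_point oner_eq0 mul0r. Qed.

Let inversion0 : {for Some 0, continuous inversion}.
Proof.
move=> A; rewrite inversionE eqxx => -[K [cK _] KA].
have [M M0 MK] := compactC_bounded cK.
apply/nbhsCP; exists M^-1; first by rewrite invr_gt0.
move=> z; rewrite subr0 => zM; apply: KA.
rewrite inversionE; case: eqVneq => [_|z0]; first by right.
left; exists z^-1 => // /MK; rewrite Normc.normcV leNgt => /negP; apply.
rewrite -[ltLHS]invrK ltf_pV2 ?posrE ?invr_gt0// lt0r normc_ge0 andbT.
by apply: contra z0 => /eqP/Normc.eq0_normc ->.
Qed.

Let inversion_infty : {for None, continuous inversion}.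
Proof.
move=> A; rewrite inversionN => /nbhsCP[e e0 eA].
exists [set z : C | Normc.normc z <= (e / 2)^-1].
  by split; [exact: compact_normc_le|exact: closed_normc_le].
move=> _ [[z /= /negP zM <-]|->]; last first.
  by change (A (inversion None)); rewrite inversionN; apply: eA; rewrite subr0 Normc.normc0.
rewrite -ltNge in zM.
have ez : 0 < e / 2 by rewrite divr_gt0.
have z0 : z != 0.
  by apply: contraTN zM => /eqP ->; rewrite Normc.normc0 -leNgt invr_ge0 ltW.
change (A (inversion (Some z))).
rewrite inversionE (negbTE z0); apply: eA; rewrite subr0 Normc.normcV.
rewrite -[ltRHS]invrK ltf_pV2 ?posrE ?invr_gt0//; last first.
  by apply: le_lt_trans zM; rewrite invr_ge0 ltW.
apply: lt_trans zM; rewrite ltf_pV2 ?posrE //.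
by rewrite ltr_pdivrMr // ltr_pMr // ltr1n.
Qed.

Let aux1 (u v s m : R) :
  u * (v + 1) * 2 < m -> m <= s + v * u -> 0 <= u -> m / 2 < s.
Proof. by move=> *; lra. Qed.

Let aux2 (e m u v s : R) : 0 < e -> 0 < m -> 0 <= u -> 0 <= v -> m / 2 < s ->
  u * (v + 1) * 2 < e * m ^+ 2 -> u * v < e * (s * m).
Proof.
move=> e0 m0 u0 v0 ms ue.
have : e * m * (m / 2) < e * m * s by rewrite ltr_pM2l // mulr_gt0.
by rewrite expr2 in ue; lra.
Qed.

Let mobius_cont_fin a b c d (z : C) : c * z + d != 0 ->
  {for Some z, continuous (mobius_map a b c d : P1 R -> P1 R)}.
Proof.
move=> cd A; rewrite /= /proj_point (negbTE cd) => /nbhsCP[e e0 eA].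
pose N := @Normc.normc R.
have N0 u : u != 0 -> 0 < N u.
  move=> u0; rewrite lt0r normc_ge0 andbT.
  by apply: contra u0 => /eqP/Normc.eq0_normc ->.
set m := N (c * z + d); have m0 : 0 < m by exact: N0.
pose D := a * d - b * c.
apply/nbhsCP.
exists (Num.min (m / 2 / (N c + 1)) (e * m ^+ 2 / 2 / (N D + 1))).
  by rewrite lt_min !divr_gt0 ?mulr_gt0 ?exprn_gt0 ?ltr_wpDl ?normc_ge0.
move=> w; rewrite lt_min !ltr_pdivlMr ?ltr_wpDl ?normc_ge0 // => /andP[w1 w2].
have dw : m / 2 < N (c * w + d).
  have : m <= N (c * w + d) + N (c * (w - z)).
    apply: le_trans (_ : N ((c * w + d) + - (c * (w - z))) <= _).
      by rewrite le_eqVlt; apply/orP; left; apply/eqP; congr N; ring.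
    by apply: le_trans (normc_triangle _ _) _; rewrite normc_opp.
  rewrite [N (c * _)]Normc.normcM => H.
  have wz0 : 0 <= N (w - z) := normc_ge0 _.
  exact: aux1 w1 H (normc_ge0 _).
have cw : c * w + d != 0.
  apply: contraTneq dw => ->; rewrite /N Normc.normc0 -leNgt.
  by rewrite divr_ge0 // ltW.
rewrite /= /proj_point (negbTE cw); apply: eA.
have -> : (a * w + b) / (c * w + d) - (a * z + b) / (c * z + d) =
    (w - z) * D / ((c * w + d) * (c * z + d)).
  by rewrite /D; field; rewrite cw cd.
rewrite !Normc.normcM Normc.normcV Normc.normcM.
rewrite ltr_pdivrMr ?mulr_gt0 ?N0//.
exact: aux2 e0 m0 (normc_ge0 _) (normc_ge0 _) dw w2.
Qed.

Let inversionK : involutive inversion.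
Proof.
apply/funeqP; rewrite -/(_ \o _) /inversion mobius_mapM; last first.
  by rewrite mulr0 mulr1 sub0r oppr_eq0 oner_neq0.
rewrite -[RHS](mobius_mapZ (oner_neq0 _)); congr mobius_map; ring.
Qed.

Let mobius_cont_some a b c d (z : C) : a * d - b * c != 0 ->
  {for Some z, continuous (mobius_map a b c d : P1 R -> P1 R)}.
Proof.
move=> D; have [cd|] := eqVneq (c * z + d) 0; last exact: mobius_cont_fin.
have E : inversion \o mobius_map a b c d = mobius_map c d a b.
  by rewrite /inversion mobius_mapM //; congr mobius_map; ring.
have -> : mobius_map a b c d = inversion \o mobius_map c d a b.
  by rewrite -E; apply/funext => x /=; rewrite inversionK.
have ab : a * z + b != 0.
  apply: contra D => /eqP ab; have [c0|c0] := eqVneq c 0.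
    by move: cd; rewrite c0 mul0r add0r => ->; rewrite !mulr0 subr0.
  have -> : a * d - b * c = a * (c * z + d) - c * (a * z + b) by ring.
  by rewrite ab cd !mulr0 subr0.
apply: continuous_comp; first exact: mobius_cont_fin.
by rewrite /= /proj_point (negbTE ab) cd mul0r.
Qed.

Lemma mobius_map_continuous a b c d : a * d - b * c != 0 ->
  continuous (mobius_map a b c d : P1 R -> P1 R).
Proof.
move=> D [z|]; first exact: mobius_cont_some.
have J1 : 0 * 0 - 1 * 1 != 0 :> R[i].
  by rewrite mulr0 mulr1 sub0r oppr_eq0 oner_neq0.
have E : mobius_map a b c d \o inversion = mobius_map b a d c.
  by rewrite /inversion mobius_mapM //; congr mobius_map; ring.
have -> : mobius_map a b c d = mobius_map b a d c \o inversion.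
  by rewrite -E; apply/funext => x /=; rewrite inversionK.
apply: continuous_comp; first exact: inversion_infty.
rewrite inversionN; apply: mobius_cont_some.
by rewrite -opprB oppr_eq0 (mulrC a) (mulrC b) in D *; rewrite mulrC (mulrC b).
Qed.

End Mobius.

(* A sphere with its projective structure: the isomorphisms from P^1(C) form a
   torsor under the Moebius group Aut(P^1(C)). *)
Record riemann_sphere (R : realType) := RiemannSphere {
  carrier :> topologicalType;
  sphere_iso : set (P1 R -> carrier);
  sphere_iso_exists : sphere_iso !=set0;
  sphere_iso_homeo : forall phi, sphere_iso phi -> exists psi,
    [/\ cancel phi psi, cancel psi phi, continuous phi & continuous psi];
  sphere_iso_torsor : forall phi psi, sphere_iso phi ->
    sphere_iso psi <-> exists2 m, mobius m & psi = phi \o m }.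

Section P1Sphere.
Context (R : realType).

Let P1_homeo (phi : P1 R -> P1 R) : mobius phi -> exists psi,
  [/\ cancel phi psi, cancel psi phi, continuous phi & continuous psi].
Proof.
move=> phiM; have [psi [psiM phiK psiK]] := mobius_inv phiM.
exists psi; split=> //.
  by case: phiM => [a [b [c [d [D ->]]]]]; exact: mobius_map_continuous.
by case: psiM => [a [b [c [d [D ->]]]]]; exact: mobius_map_continuous.
Qed.

Let P1_torsor (phi psi : P1 R -> P1 R) : mobius phi ->
  mobius psi <-> exists2 m, mobius m & psi = phi \o m.
Proof.
move=> phiM; split=> [psiM|[m mM ->]]; last exact: mobius_comp.
have [phi' [phi'M phiK phi'K]] := mobius_inv phiM.
exists (phi' \o psi); first exact: mobius_comp.
by apply/funext => p /=; rewrite phi'K.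
Qed.

Definition P1_sphere : riemann_sphere R :=
  RiemannSphere (ex_intro _ _ (@mobius_id R)) P1_homeo P1_torsor.

End P1Sphere.

Section Maps.
Context {R : realType}.
Implicit Types S T : riemann_sphere R.
Local Notation C := (R[i])^o.

(* At infinity both polynomials are homogenized in degree d. *)
Definition rational_map (d : nat) (f : P1 R -> P1 R) : Prop :=
  exists P Q : {poly R[i]}, [/\ coprimep P Q,
    maxn (size P) (size Q) = d.+1 &
    forall p, f p = if p is Some z then proj_point P.[z] Q.[z]
                    else proj_point P`_d Q`_d].

Definition sphere_inv {S} (phi : P1 R -> S) : S -> P1 R := pinv setT phi.

(* The value 0 at infinity is irrelevant: it is only used away from there. *)
Definition affine_coord (p : P1 R) : C := odflt 0 p.

Definition in_charts {S T} (phi : P1 R -> S) (psi : P1 R -> T) (f : S -> T) :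
  C -> C := fun z => affine_coord (sphere_inv psi (f (phi (Some z)))).

Definition holomorphic {S T} (f : S -> T) : Prop :=
  continuous f /\
  forall phi psi (z : C), sphere_iso phi -> sphere_iso psi ->
    f (phi (Some z)) <> psi None -> derivable (in_charts phi psi f) z 1.

Definition ramified_cover {S T} (f : S -> T) : Prop :=
  holomorphic f /\ exists p q, f p <> f q.

(* In charts centered at x and f x, f is z |-> z ^ k h(z) with h holomorphic
   and nonzero at 0. *)
Definition has_local_degree {S T} (f : S -> T) (x : S) (k : nat) : Prop :=
  exists phi psi, [/\ sphere_iso phi, sphere_iso psi,
    phi (Some 0) = x, psi (Some 0) = f x &
    exists h : C -> C, [/\ \forall z \near 0, derivable h z 1, h 0 != 0 &
      \forall z \near 0, in_charts phi psi f z = z ^+ k * h z]].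

Definition local_degree {S T} (f : S -> T) (x : S) : nat :=
  xget 0%N [set k | has_local_degree f x k].

End Maps.

Section Topology.
Context {S T : topologicalType}.

Definition homeo_on (V : set S) (U : set T) (f : S -> T) : Prop :=
  exists g : T -> S, [/\ f @` V `<=` U, g @` U `<=` V,
    forall x, V x -> g (f x) = x, forall y, U y -> f (g y) = y &
    {within V, continuous f} /\ {within U, continuous g}].

(* For open D and E: neighborhoods and sheets are open in the ambient spaces. *)
Definition covering_map (D : set S) (E : set T) (f : S -> T) : Prop :=
  f @` D = E /\
  forall y, E y -> exists U, [/\ open U, U y, U `<=` E &
    exists sheets : set (set S), [/\ trivIset sheets id,
      \bigcup_(V in sheets) V = D `&` f @^-1` U &
      forall V, sheets V -> open V /\ homeo_on V U f]].

(* The target is meant to be compact Hausdorff: its unique uniformity consists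
   of the neighborhoods W of the diagonal. *)
Definition cvg_loc_unif (D : set S) (f_ : nat -> S -> T) (f : S -> T) : Prop :=
  forall x, D x -> exists2 B, nbhs x B &
    forall W : set (T * T), (forall y : T, nbhs (y, y) W) ->
      \forall n \near \oo, forall u, B u -> W (f_ n u, f u).

End Topology.

(* All marked points and vertices live in one finite type U, so that a vertex
   of T^X being a vertex of T^Y is literal membership. Functions and relations
   on U are only meaningful on the relevant subset. *)
Section Trees.
Context {R : realType} {U : finType}.
Implicit Types X Y Z : {set U}.

Record portrait Y Z (d : nat) := Portrait {
  pmap :> U -> U;
  pdeg : U -> nat;
  pmap_in : forall a, a \in Y -> pmap a \in Z;
  pdeg_range : forall a, a \in Y -> (1 <= pdeg a <= d)%N;
  pdeg_ramification : (\sum_(a in Y) (pdeg a - 1) = 2 * d - 2)%N;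
  pdeg_fiber : forall b, b \in Z ->
    (\sum_(a in Y | pmap a == b) pdeg a = d)%N }.

Record comb_tree X := CombTree {
  vert : {set U};
  adj : rel U;
  adj_sym : symmetric adj;
  adj_irr : irreflexive adj;
  adj_vert : forall u v, adj u v -> u \in vert;
  tree_connected : {in vert &, forall u v, connect adj u v};
  tree_acyclic : forall s : seq U, ucycle adj s -> (size s <= 2)%N;
  tree_leaves : forall v, (v \in X) = (v \in vert) && (#|adj v| == 1%N);
  tree_valence : forall v, v \in vert -> v \notin X -> (3 <= #|adj v|)%N;
  tree_marks : (3 <= #|X|)%N }.

Definition internal X (T : comb_tree X) (v : U) : bool :=
  (v \in vert T) && (v \notin X).

(* The neighbor u of v such that the edge {v, u} lies in the component of
   T \ {v} containing x. *)
Definition toward X (T : comb_tree X) (v x : U) : U :=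
  odflt v [pick u | adj T v u &&
    connect [rel a b | [&& adj T a b, a != v & b != v]] u x].

(* An edge at v is named by its other endpoint: attach v u is i_v({v, u}). *)
Record sphere_tree X := SphereTree {
  skel :> comb_tree X;
  sph : U -> riemann_sphere R;
  attach : forall v, U -> sph v;
  attach_inj : forall v, internal skel v ->
    {in adj skel v &, injective (attach v)} }.

Arguments attach {X} T v u : rename.

Definition special X (T : sphere_tree X) (v : U) : set (sph T v) :=
  attach T v @` [set u | adj T v u].

Definition mark X (T : sphere_tree X) (v x : U) : sph T v :=
  attach T v (toward T v x).

Arguments special {X} T v.
Arguments mark {X} T v x.

Record tree_cover Y Z := TreeCover {
  src : sphere_tree Y;
  tgt : sphere_tree Z;
  tmap : U -> U;
  vmap : forall v, sph src v -> sph tgt (tmap v);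
  tmap_internal : forall v, internal src v -> internal tgt (tmap v);
  tmap_leaf : forall v, v \in Y -> tmap v \in Z;
  tmap_adj : forall u v, adj src u v -> adj tgt (tmap u) (tmap v);
  vmap_ramified : forall v, internal src v -> ramified_cover (@vmap v);
  vmap_covering : forall v, internal src v ->
    covering_map (~` special src v) (~` special tgt (tmap v)) (@vmap v);
  vmap_attach : forall v u, internal src v -> adj src v u ->
    vmap (attach src v u) = attach tgt (tmap v) (tmap u);
  vmap_degree : forall v v', internal src v -> internal src v' ->
    adj src v v' -> local_degree (@vmap v) (attach src v v') =
                    local_degree (@vmap v') (attach src v' v) }.

Arguments vmap {Y Z} G v p : rename.

Definition has_portrait Y Z d (F : portrait Y Z d) (G : tree_cover Y Z) :
  Prop := forall y, y \in Y -> tmap G y = F y /\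
    forall v, internal (src G) v -> adj (src G) v y ->
      local_degree (vmap G v) (attach (src G) v y) = pdeg F y.

(* Spheres carried by different trees are compared as pairs (sphere, point). *)
Definition same_point (S T : riemann_sphere R) (p : S) (q : T) : Prop :=
  existT (fun S : riemann_sphere R => S : Type) S p = existT _ T q.

Definition same_iso (S T : riemann_sphere R) (phi : P1 R -> S)
    (psi : P1 R -> T) : Prop :=
  existT (fun S : riemann_sphere R => P1 R -> S) S phi = existT _ T psi.

Definition dyn_system Y Z d (F : portrait Y Z d) X (G : tree_cover Y Z)
    (TX : sphere_tree X) : Prop :=
  has_portrait F G /\
  forall v, internal TX v ->
    [/\ internal (src G) v, internal (tgt G) v,
        sph TX v = sph (src G) v, sph TX v = sph (tgt G) v &
        forall x, x \in X -> same_point (mark TX v x) (mark (src G) v x) /\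
                             same_point (mark TX v x) (mark (tgt G) v x)].

Record marked_map := MarkedMap {
  mm_map :> P1 R -> P1 R;
  mm_src : U -> P1 R;
  mm_tgt : U -> P1 R }.

Definition rat_system Y Z d (F : portrait Y Z d) X : set marked_map :=
  [set f : marked_map | [/\ rational_map d f,
    {in Y &, injective (mm_src f)} /\ {in Z &, injective (mm_tgt f)},
    forall a, a \in Y -> f (mm_src f a) = mm_tgt f (F a),
    forall a, a \in Y ->
      @local_degree R (P1_sphere R) (P1_sphere R) f (mm_src f a) = pdeg F a &
    forall x, x \in X -> mm_src f x = mm_tgt f x]].

Definition cvg_cover_wrt Y Z (f_ : nat -> marked_map) (G : tree_cover Y Z)
    (phiY : nat -> forall v, P1 R -> sph (src G) v)
    (phiZ : nat -> forall w, P1 R -> sph (tgt G) w) : Prop :=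
  forall v, internal (src G) v -> let w := tmap G v in
    [/\ forall n, sphere_iso (phiY n v) /\ sphere_iso (phiZ n w),
        forall y, y \in Y ->
          phiY n v (mm_src (f_ n) y) @[n --> \oo] --> mark (src G) v y,
        forall z, z \in Z ->
          phiZ n w (mm_tgt (f_ n) z) @[n --> \oo] --> mark (tgt G) w z &
        cvg_loc_unif (~` special (src G) v)
          (fun n => phiZ n w \o f_ n \o sphere_inv (phiY n v)) (vmap G v)].

Definition cvg_cover Y Z (f_ : nat -> marked_map) (G : tree_cover Y Z) : Prop :=
  exists phiY phiZ, @cvg_cover_wrt Y Z f_ G phiY phiZ.

Definition dyn_cvg X Y Z (f_ : nat -> marked_map) (G : tree_cover Y Z)
    (TX : sphere_tree X) : Prop :=
  exists phiY phiZ, @cvg_cover_wrt Y Z f_ G phiY phiZ /\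
    forall n v, internal TX v -> same_iso (phiY n v) (phiZ n v).

End Trees.

Arguments sphere_tree R {U} X.
Arguments tree_cover R {U} Y Z.
Arguments marked_map R U : clear implicits.
Arguments special {R U X} T v _.
Arguments mark {R U X} T v x.
Arguments vmap {R U Y Z} G v p : rename.

(* Main.v *)
Require Import Defs.
From mathcomp Require Import all_boot all_order all_algebra.
From mathcomp Require Import complex ring finmap.
From mathcomp Require Import all_classical all_reals all_analysis.
Set Implicit Arguments.
Unset Strict Implicit.
Unset Printing Implicit Defensive.
Import Order.TTheory GRing.Theory Num.Theory.
Import numFieldNormedType.Exports.
Local Open Scope classical_set_scope.
Local Open Scope ring_scope.

(** Only the passage from convergence to dynamical convergence needs an
    argument. Let [(phiY, phiZ)] witness the convergence to [G], and keep
    [phiY]. At an internal vertex [w] of [T^X] the chart [phiZ n w] is replaced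
    by [phiY n w]; elsewhere [phiZ n w] stays.

    If such a [w] is the image of an internal vertex of [T^Y], the old and the
    new charts at [w] both send the marked points indexed by [X] to points
    tending to the same limits. Every branch of [T^X] at [w] contains a mark of
    [X], because [T^X] is a finite tree, so that at least three of these limits
    are distinct ([three_distinct_marks]). A Moebius map is determined,
    continuously, by its values at three points, hence the changes of charts
    [phiY n w \o (phiZ n w)^-1] tend to the identity ([mobius_cvg_id],
    [charts_asymptotic]). The sphere is compact, so this convergence is uniform
    and the limits of the marked points and of the covers survive the
    replacement ([charts_loc_unif]). If [w] is not the image of an internal
    vertex, the convergence of covers does not constrain the charts of the
    target at [w]. *)

(** * Branches of a marked tree *)

Section TreeBranches.
Context {U : finType} {X : {set U}} (T : comb_tree X).

Definition avoiding (v : U) : rel U :=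
  [rel a b | [&& adj T a b, a != v & b != v]].

Lemma connect_avoiding_sym v : connect_sym (avoiding v).
Proof.
by apply: sym_connect_sym => a b;
  rewrite /avoiding /= (adj_sym T) [(a != v) && _]andbC.
Qed.

Lemma avoiding_path v a s : path (avoiding v) a s -> path (adj T) a s.
Proof. by apply: sub_path => x y /= /andP[]. Qed.

Lemma avoiding_notin v a s : a != v -> path (avoiding v) a s -> v \notin a :: s.
Proof.
move=> av; elim: s a av => [|b s IH] a av /=; first by rewrite inE eq_sym av.
by move=> /andP[/and3P[_ _ bv] /(IH _ bv) H]; rewrite inE eq_sym (negbTE av).
Qed.

(** The path [w :: s] is listed from its tip [w] back through [v]. In a finite
    tree it cannot be prolonged forever, and a tip that has no neighbor off the
    path has no neighbor but its predecessor, for lack of cycles: it is a leaf.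
    The number [n] bounds how many vertices can still be added. *)
Lemma branch_path_leaf v u n w s : (#|U| <= size s + n)%N ->
  path (adj T) w s -> uniq (w :: s) -> v \in s -> connect (avoiding v) u w ->
  exists2 x, x \in X & connect (avoiding v) u x.
Proof.
elim: n w s => [|n IH] w s sz pws uws vs uw.
  have := max_card (mem (w :: s)); rewrite (card_uniqP uws) /= leqNgt.
  by rewrite ltnS -[size s]addn0 sz.
have wv : w != v by apply: contraTneq uws => ->; rewrite /= vs.
have [/existsP[y /andP[wy ys]]|noext] :=
  boolP [exists y, adj T w y && (y \notin w :: s)].
  have yv : y != v by apply: contraNneq ys => ->; rewrite inE vs orbT.
  apply: (IH y (w :: s)); rewrite ?addSnnS //.
  - by rewrite /= (adj_sym T) wy.
  - by rewrite cons_uniq ys.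
  - by rewrite inE vs orbT.
  - by apply: connect_trans uw (connect1 _); rewrite /avoiding /= wy wv.
exists w => //; rewrite (tree_leaves T).
case: s pws uws vs noext {sz} => [//|h s] pws uws vs noext.
have wh : adj T w h by case/andP: pws.
rewrite (adj_vert wh) /=; apply/eqP; rewrite -(card1 h); apply: eq_card => y.
rewrite !inE; apply/idP/eqP => [wy|->//].
have {}wy : adj T w y := wy.
move: noext; rewrite negb_exists => /forallP/(_ y).
rewrite /= wy /= negbK !inE => /or3P[/eqP yw|/eqP//|ys].
  by move: wy; rewrite yw (adj_irr T).
case/splitPr: ys pws uws => s1 s2 pws uws {vs}.
(* a neighbor y further back on the path would close a cycle *)
have /(tree_acyclic (c := T)) : ucycle (adj T) (w :: h :: rcons s1 y).
  rewrite /ucycle; apply/andP; split.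
    move: pws; rewrite /= rcons_path last_rcons -cat_rcons cat_path.
    by rewrite (adj_sym T y) wy andbT => /and3P[-> ->].
  by move: uws; rewrite -cat_rcons -!cat_cons cat_uniq => /andP[].
by rewrite /= size_rcons.
Qed.

Lemma branch_has_leaf v u : adj T v u ->
  exists2 x, x \in X & connect (avoiding v) u x.
Proof.
move=> vu; apply: (@branch_path_leaf v u #|U| u [:: v]).
- by rewrite leq_addl.
- by rewrite /= (adj_sym T) vu.
- by rewrite /= !inE andbT; apply: contraTneq vu => ->; rewrite (adj_irr T).
- by rewrite inE.
- exact: connect0.
Qed.

(** Two neighbors of [v] joined outside [v] would form a cycle with it, so each
    branch at [v] is named by a single neighbor. *)
Lemma branch_neighbor_unique v u w : adj T v u -> adj T v w ->
  connect (avoiding v) u w -> u = w.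
Proof.
move=> vu vw /connectP[s0 ps0 wE]; rewrite {}wE in vw *.
case: (shortenP ps0) vw => s ps us _ vw {s0 ps0}.
have uv : u != v by apply: contraTneq vu => ->; rewrite (adj_irr T).
have /(tree_acyclic (c := T)) : ucycle (adj T) (v :: u :: s).
  apply/andP; split; last by rewrite cons_uniq us avoiding_notin.
  by rewrite /= rcons_path vu (avoiding_path ps) (adj_sym T) vw.
by case: s {ps us vw}.
Qed.

Lemma toward_hits_neighbor v u : adj T v u ->
  exists2 x, x \in X & toward T v x = u.
Proof.
move=> vu; have [x xX ux] := branch_has_leaf vu; exists x => //.
rewrite /toward; case: pickP => [w /andP[vw wx]|/(_ u)]; last first.
  by rewrite vu ux.
apply: (branch_neighbor_unique vw vu).
by apply: connect_trans wx _; rewrite connect_avoiding_sym.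
Qed.

End TreeBranches.

(** The marks of [X] reach every edge at [v], and there are at least three. *)
Lemma three_distinct_marks {R : realType} {U : finType} {X : {set U}}
    (T : sphere_tree R X) (v : U) : internal T v ->
  exists x1 x2 x3, [/\ x1 \in X, x2 \in X & x3 \in X] /\
    [/\ mark T v x1 <> mark T v x2, mark T v x2 <> mark T v x3 &
        mark T v x3 <> mark T v x1].
Proof.
move=> iv; have /andP[vT vX] := iv.
have /card_gt2P[u1 [u2 [u3 [[a1 a2 a3] [n12 n23 n31]]]]] := tree_valence vT vX.
have [x1 X1 t1] := toward_hits_neighbor a1.
have [x2 X2 t2] := toward_hits_neighbor a2.
have [x3 X3 t3] := toward_hits_neighbor a3.
exists x1, x2, x3; split => //; rewrite /mark t1 t2 t3.
split=> /(attach_inj iv) E; [move: n12|move: n23|move: n31];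
  by rewrite E ?eqxx.
Qed.

(** * Moebius maps that nearly fix three points *)

Section InterpolationLimit.
Context {K : numFieldType}.

Lemma cvg_neq (P Q : nat -> K^o) (s t : K^o) : s != t ->
  P @ \oo --> s -> Q @ \oo --> t -> \forall n \near \oo, P n != Q n.
Proof.
move=> st fs gt.
have : P \- Q @ \oo --> s - t by exact: cvgB.
move=> /cvgr_neq0; rewrite subr_eq0 => /(_ st).
by apply: filterS => n; rewrite subr_eq0.
Qed.

(** The coefficients are those of [mobius_interp]. When source and target
    points have the same limits, [u] and [v] tend to 1, so the coefficients tend
    to those of the identity matrix. Convergence is joint in the map and the
    point, which is the form that compactness turns into uniformity. *)
Lemma interp_cvg_id (P P' Q Q' S S' : nat -> K^o) (a b c x : K^o)
    (u := fun n => (Q' n - S' n) / (Q n - S n) : K)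
    (v := fun n => (S' n - P' n) / (S n - P n) : K)
    (c1 := fun n => (u n - v n) / (P n - Q n) : K)
    (d1 := fun n => u n - c1 n * P n : K)
    (a1 := fun n => (P' n * u n - Q' n * v n) / (P n - Q n) : K)
    (b1 := fun n => P' n * u n - a1 n * P n : K) :
  a != b -> b != c -> c != a ->
  P @ \oo --> a -> P' @ \oo --> a ->
  Q @ \oo --> b -> Q' @ \oo --> b ->
  S @ \oo --> c -> S' @ \oo --> c ->
  let num (nz : nat * K^o) : K^o := a1 nz.1 * nz.2 + b1 nz.1 in
  let den (nz : nat * K^o) : K^o := c1 nz.1 * nz.2 + d1 nz.1 in
  (\forall nz \near (\oo, nbhs x), den nz != 0) /\
  num nz / den nz @[nz --> (\oo, nbhs x)] --> x.
Proof.
move=> ab bc ca Pa Pa' Qb Qb' Sc Sc' num den.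
have u1 : u @ \oo --> (1 : K^o).
  rewrite -[1 : K^o](divff (x := b - c)) ?subr_eq0 //.
  by apply: cvgM; [exact: cvgB|apply: cvgV; [rewrite subr_eq0|exact: cvgB]].
have v1 : v @ \oo --> (1 : K^o).
  rewrite -[1 : K^o](divff (x := c - a)) ?subr_eq0 //.
  by apply: cvgM; [exact: cvgB|apply: cvgV; [rewrite subr_eq0|exact: cvgB]].
have c0 : c1 @ \oo --> (0 : K^o).
  rewrite -[0 : K^o](mul0r ((a - b)^-1)) -(subrr (1 : K)).
  by apply: cvgM; [exact: cvgB|apply: cvgV; [rewrite subr_eq0|exact: cvgB]].
have d_1 : d1 @ \oo --> (1 : K^o).
  rewrite -[1 : K^o](subr0 1) -(mul0r (a : K)).
  by apply: cvgB => //; exact: cvgM.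
have a_1 : a1 @ \oo --> (1 : K^o).
  rewrite -[1 : K^o](divff (x := a - b)) ?subr_eq0 //.
  apply: cvgM; last by apply: cvgV; [rewrite subr_eq0|exact: cvgB].
  rewrite -[a in a - b]mulr1 -[b in _ - b]mulr1.
  by apply: cvgB; exact: cvgM.
have b_0 : b1 @ \oo --> (0 : K^o).
  rewrite -[0 : K^o](subrr (a : K)) -[a in a - _]mulr1 -[a in _ - a]mul1r.
  by apply: cvgB; exact: cvgM.
have fst_cvg (g : nat -> K^o) (l : K^o) : g @ \oo --> l ->
    g nz.1 @[nz --> (\oo, nbhs x)] --> l.
  by move=> gl; apply: (@cvg_comp _ _ _ fst g _ \oo) => //; exact: cvg_fst.
have z_x : nz.2 @[nz --> (@nbhs nat _ \oo, nbhs x)] --> x by exact: cvg_snd.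
have den1 : den nz @[nz --> (\oo, nbhs x)] --> (1 : K^o).
  rewrite -[1 : K^o](add0r 1) -(mul0r (x : K)).
  by apply: cvgD; [apply: cvgM => //; exact: fst_cvg|exact: fst_cvg].
split; first by move: den1 => /cvgr_neq0; apply; exact: oner_neq0.
rewrite -[x in _ --> x]mulr1 -(invr1 K).
apply: cvgM; last by apply: cvgV => //; exact: oner_neq0.
rewrite -[x in _ --> x]addr0 -[x in x + 0]mul1r.
by apply: cvgD; [apply: cvgM => //; exact: fst_cvg|exact: fst_cvg].
Qed.

End InterpolationLimit.

Section MobiusLimit.
Context {R : realType}.
Local Notation C := (R[i])^o.

Lemma mobius_map_scale (k a b c d : R[i]) : k != 0 ->
  mobius_map (k * a) (k * b) (k * c) (k * d) = mobius_map a b c d.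
Proof.
move=> k0.
have pp n m : proj_point (k * n) (k * m) = proj_point n m :> P1 R.
  rewrite /proj_point mulf_eq0 (negbTE k0) /=; case: eqP => // /eqP m0.
  by congr Some; field; rewrite k0 m0.
by apply/funext => -[z|] /=; rewrite -?mulrA -?mulrDr pp.
Qed.

(** A matrix of [m] sends the vectors (p, 1), (q, 1), (r, 1) to multiples of
    (p', 1), (q', 1), (r', 1). The linear relation between the three vectors on
    each side fixes the ratio of the first two factors; they are normalized here
    to be [u] and [v], divided differences that are close to 1 when the points
    hardly move. Two images then give the matrix. *)
Lemma mobius_interp (m : P1 R -> P1 R) (p q r p' q' r' : R[i]) : mobius m ->
  m (Some p) = Some p' -> m (Some q) = Some q' -> m (Some r) = Some r' ->
  p != q -> q != r -> r != p -> q' != r' ->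
  let u := (q' - r') / (q - r) in
  let v := (r' - p') / (r - p) in
  let c := (u - v) / (p - q) in
  let d := u - c * p in
  let a := (p' * u - q' * v) / (p - q) in
  let b := p' * u - a * p in
  m = mobius_map a b c d.
Proof.
move=> [a [b [c [d [D ->]]]]] /= mp mq mr pq qr rp qr'.
have val z z' : proj_point (a * z + b) (c * z + d) = Some z' :> P1 R ->
    c * z + d != 0 /\ z' * (c * z + d) = a * z + b.
  rewrite /proj_point; case: eqP => // /eqP cd [<-]; split => //.
  by field.
have [u0 ep] := val _ _ mp; have [_ eq] := val _ _ mq; have [_ er] := val _ _ mr.
rewrite -subr_eq0 in pq; rewrite -subr_eq0 in qr; rewrite -subr_eq0 in rp.
rewrite -subr_eq0 in qr'.
set u := c * p + d in u0 ep; set v := c * q + d in eq.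
(* the relation between the three vectors, with the factor at r eliminated *)
have H : v * (q' - r') * (r - p) = u * (r' - p') * (q - r).
  apply/eqP; rewrite -subr_eq0; apply/eqP.
  transitivity ((r - p) * (q' * v) + (q - r) * (p' * u)
    + (p - q) * (r' * (c * r + d))); first by rewrite /u /v; ring.
  by rewrite ep eq er; ring.
have cE : c = (u - v) / (p - q) by rewrite /u /v; field.
have dE : d = u - c * p by rewrite /u; ring.
have aE : a = (p' * u - q' * v) / (p - q) by rewrite ep eq; field.
have bE : b = p' * u - a * p by rewrite ep; ring.
set k := u / ((q' - r') / (q - r)).
have k0 : k != 0 by rewrite /k !mulf_neq0 ?invr_eq0 ?mulf_neq0 ?invr_eq0.
have uE : u = k * ((q' - r') / (q - r)) by rewrite /k; field; rewrite qr qr'.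
have vE : v = k * ((r' - p') / (r - p)).
  apply: (mulIf qr'); apply: (mulIf rp); rewrite H /k.
  by field; rewrite qr rp qr'.
rewrite -[RHS](mobius_map_scale _ _ _ _ k0); congr mobius_map.
- by rewrite aE uE vE; ring.
- by rewrite bE aE uE vE; ring.
- by rewrite cE uE vE; ring.
- by rewrite dE cE uE vE; ring.
Qed.

Lemma cvg_Some {I : Type} (F : set_system I) {FF : Filter F} (f : I -> P1 R)
    (z : C) : f i @[i --> F] --> (Some z : P1 R) ->
  (\forall i \near F, f i = Some (affine_coord (f i))) /\
  affine_coord (f i) @[i --> F] --> z.
Proof.
move=> fz; split.
  apply: (fz [set p | p = Some (affine_coord p)]).
  by rewrite /nbhs /=; near=> w.
move=> A zA; apply: (fz [set p | A (affine_coord p)]).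
by apply: filterS zA => w.
Unshelve. all: by end_near.
Qed.

(** For large [n] all the points are finite and distinct, and [m n] is given by
    the interpolation formula. *)
Lemma mobius_cvg_id (m : nat -> P1 R -> P1 R) (p q r : nat -> P1 R)
    (a b c x : C) : (forall n, mobius (m n)) ->
  a != b -> b != c -> c != a ->
  p n @[n --> \oo] --> (Some a : P1 R) -> m n (p n) @[n --> \oo] --> (Some a : P1 R) ->
  q n @[n --> \oo] --> (Some b : P1 R) -> m n (q n) @[n --> \oo] --> (Some b : P1 R) ->
  r n @[n --> \oo] --> (Some c : P1 R) -> m n (r n) @[n --> \oo] --> (Some c : P1 R) ->
  m nz.1 (Some nz.2) @[nz --> (\oo, nbhs x)] --> (Some x : P1 R).
Proof.
move=> mm ab bc ca /cvg_Some[pS pa] /cvg_Some[pS' pa'] /cvg_Some[qS qb]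
  /cvg_Some[qS' qb'] /cvg_Some[rS rc] /cvg_Some[rS' rc'].
set P : nat -> C := fun n => affine_coord (p n) in pS pa.
set P' : nat -> C := fun n => affine_coord (m n (p n)) in pS' pa'.
set Q : nat -> C := fun n => affine_coord (q n) in qS qb.
set Q' : nat -> C := fun n => affine_coord (m n (q n)) in qS' qb'.
set S : nat -> C := fun n => affine_coord (r n) in rS rc.
set S' : nat -> C := fun n => affine_coord (m n (r n)) in rS' rc'.
have [dn0 qx] := interp_cvg_id (K := R[i]) x ab bc ca pa pa' qb qb' rc rc'.
have near1 (N : nat -> Prop) : (\forall n \near \oo, N n) ->
    \forall nz \near (\oo, nbhs x), N nz.1.
  by move=> HN; exact: (@cvg_fst _ _ \oo (nbhs x) _ _ HN).
have PQ := near1 _ (cvg_neq ab pa qb).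
have QS := near1 _ (cvg_neq bc qb rc).
have SP := near1 _ (cvg_neq ca rc pa).
have QS' := near1 _ (cvg_neq bc qb' rc').
move: pS qS rS pS' qS' rS' => /near1 pS /near1 qS /near1 rS /near1 pS'
  /near1 qS' /near1 rS' A /qx Ax.
move: Ax; rewrite /nbhs /=; apply: filter_app; near=> nz => /= Ax.
rewrite (@mobius_interp (m nz.1) (P nz.1) (Q nz.1) (S nz.1)
  (P' nz.1) (Q' nz.1) (S' nz.1)) //=.
- rewrite /proj_point ifN; first exact: Ax.
  by near: nz.
- by rewrite -(near pS nz) // (near pS' nz).
- by rewrite -(near qS nz) // (near qS' nz).
- by rewrite -(near rS nz) // (near rS' nz).
- by near: nz.
- by near: nz.
- by near: nz.
- by near: nz.
Unshelve. all: by end_near.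
Qed.

End MobiusLimit.

(** * Asymptotic charts of a sphere *)

Section Charts.
Context {R : realType}.
Local Notation C := (R[i])^o.
Implicit Types S : riemann_sphere R.

Lemma mobius_infty (p : P1 R) : exists2 m, mobius m & m None = p.
Proof.
case: p => [z|]; last by exists id; [exact: mobius_id|].
exists (mobius_map z 1 1 0).
  exists z, 1, 1, 0; split=> //.
  by rewrite mulr0 mulr1 sub0r oppr_eq0 oner_neq0.
by rewrite /= /proj_point oner_eq0 divr1.
Qed.

Lemma P1_infinite (s : seq (P1 R)) : exists p, p \notin s.
Proof.
pose t := [seq (Some (k%:R : R[i]) : P1 R) | k <- iota 0 (size s).+1].
have ut : uniq t.
  rewrite map_inj_uniq ?iota_uniq // => i j [] /eqP.
  by rewrite eqr_nat => /eqP.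
apply: contrapT => /forallNP sp.
suff : (size t <= size s)%N by rewrite size_map size_iota ltnn.
by apply: uniq_leq_size => // p _; apply: contrapT => /negP; exact: sp.
Qed.

(** Lets finitely many points of a sphere be treated as complex numbers. *)
Lemma chart_avoiding S (s : seq S) : exists2 th : P1 R -> S,
  sphere_iso th & forall x, x \in s -> th None <> x.
Proof.
have [th0 iso0] := sphere_iso_exists S.
have [et [th0K etK _ _]] := sphere_iso_homeo iso0.
have [p ps] := P1_infinite [seq et x | x <- s].
have [m mM mp] := mobius_infty p.
exists (th0 \o m); first by apply/(sphere_iso_torsor _ iso0); exists m.
move=> x xs /= E; move/negP: ps; apply; rewrite -mp -(th0K (m None)) E.
exact: map_f.
Qed.

(** The conclusion says that [phi n \o (psi n)^-1] tends to the identity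
    continuously at [x]. Read in a chart whose infinity is none of [a], [b], [c],
    [x], these are Moebius maps and [mobius_cvg_id] applies. *)
Lemma charts_asymptotic S (phi psi : nat -> P1 R -> S) (p q r : nat -> P1 R)
    (a b c x : S) :
  (forall n, sphere_iso (phi n)) -> (forall n, sphere_iso (psi n)) ->
  a <> b -> b <> c -> c <> a ->
  phi n (p n) @[n --> \oo] --> a -> psi n (p n) @[n --> \oo] --> a ->
  phi n (q n) @[n --> \oo] --> b -> psi n (q n) @[n --> \oo] --> b ->
  phi n (r n) @[n --> \oo] --> c -> psi n (r n) @[n --> \oo] --> c ->
  forall A, nbhs x A -> exists2 B, nbhs x B &
    \forall n \near \oo, forall z, B (psi n z) -> A (phi n z).
Proof.
move=> phiI psiI ab bc ca pa pa' qb qb' rc rc' A xA.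
have [th thI thN] := chart_avoiding [:: a; b; c; x].
have [et [thK etK thc etc]] := sphere_iso_homeo thI.
have fin y : y \in [:: a; b; c; x] -> exists z : C, et y = Some z.
  move=> ys; case E: (et y) => [z|]; first by exists z.
  by case: (thN y ys); rewrite -E etK.
have [a1 aE] := fin a ltac:(by rewrite !inE eqxx ?orbT).
have [b1 bE] := fin b ltac:(by rewrite !inE eqxx ?orbT).
have [c1 cE] := fin c ltac:(by rewrite !inE eqxx ?orbT).
have [x1 xE] := fin x ltac:(by rewrite !inE eqxx ?orbT).
have neq y z y1 z1 : et y = Some y1 -> et z = Some z1 -> y <> z -> y1 != z1.
  move=> yE zE yz; apply: contra_notN yz => /eqP yz1.
  by rewrite -(etK y) -(etK z) yE zE yz1.
have chart (ph : nat -> P1 R -> S) : (forall n, sphere_iso (ph n)) ->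
    forall n, mobius (et \o ph n).
  move=> phI n; have /(sphere_iso_torsor _ thI)[m mM ->] := phI n.
  by rewrite (_ : et \o (th \o m) = m) //; apply/funext => z /=; rewrite thK.
have /choice[g gP] : forall n, exists g, [/\ mobius g,
    cancel (et \o psi n) g & cancel g (et \o psi n)].
  by move=> n; apply: mobius_inv; exact: chart.
pose m n := (et \o phi n) \o g n.
have mM n : mobius (m n).
  by have [gM _ _] := gP n; apply: mobius_comp gM; exact: chart.
have gK n z : g n (et (psi n z)) = z by have [_ gK _] := gP n; exact: gK.
have pull (ph : nat -> P1 R -> S) (s : nat -> P1 R) y y1 : et y = Some y1 ->
    ph n (s n) @[n --> \oo] --> y ->
    et (ph n (s n)) @[n --> \oo] --> (Some y1 : P1 R).
  by move=> <- sy; apply: (cvg_comp _ _ sy); exact: etc.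
have mpull (s : nat -> P1 R) y y1 : et y = Some y1 ->
    phi n (s n) @[n --> \oo] --> y ->
    m n (et (psi n (s n))) @[n --> \oo] --> (Some y1 : P1 R).
  move=> yE /(pull _ _ _ _ yE) sy.
  by rewrite (_ : (fun n => _) = (fun n => et (phi n (s n)))) //;
    apply/funext => n; rewrite /m /= gK.
have := mobius_cvg_id (x := x1) mM (neq _ _ _ _ aE bE ab) (neq _ _ _ _ bE cE bc)
  (neq _ _ _ _ cE aE ca) (pull _ _ _ _ aE pa') (mpull _ _ _ aE pa)
  (pull _ _ _ _ bE qb') (mpull _ _ _ bE qb)
  (pull _ _ _ _ cE rc') (mpull _ _ _ cE rc).
have xA' : nbhs (Some x1 : P1 R) (th @^-1` A).
  by rewrite -xE; apply: thc; rewrite etK.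
move=> /(_ _ xA')[[N B] /= [Noo Bx] NB].
exists (et @^-1` (Some @` B)).
  by apply: etc; rewrite xE; exact: one_point_compactification_some_nbhs.
apply: filterS Noo => n Nn z /= [w Bw wE].
have := NB (n, w) (conj Nn Bw); rewrite /= wE.
by rewrite /m /= gK etK.
Qed.

(** Around each point there is an open set [E] such that [phi n z] is [W]-close
    to every point of [E] once [psi n z] is in [E] and [n] is large. Finitely
    many of them cover the compact sphere, and the union of their squares is a
    neighborhood of the diagonal: for large [n], closeness of [psi n z] to a
    point in the sense of this union implies [W]-closeness of [phi n z]. *)
Lemma charts_loc_unif (T : topologicalType) S (D : set T)
    (phi psi : nat -> P1 R -> S) (g : nat -> T -> P1 R) (h : T -> S) :
  (forall (x : S) (A : set S), nbhs x A -> exists2 B, nbhs x B &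
    \forall n \near \oo, forall z, B (psi n z) -> A (phi n z)) ->
  cvg_loc_unif D (fun n => psi n \o g n) h ->
  cvg_loc_unif D (fun n => phi n \o g n) h.
Proof.
move=> near_id cv t Dt; have [B tB cvB] := cv t Dt; exists B => // W diagW.
have sq (x : S) : exists E : set S, open_nbhs x E /\
    \forall n \near \oo, forall z s, E (psi n z) -> E s -> W (phi n z, s).
  have [[A1 A2] /= [xA1 xA2] AW] := diagW x.
  have [E1 xE1 E1A] := near_id x A1 xA1.
  have : nbhs x (E1 `&` A2) by exact: filterI.
  rewrite nbhsE => -[E xE EE]; exists E; split => //.
  apply: filterS E1A => n E1A z s /EE[Ez _] /EE[_ As].
  by apply: (AW (_, _)); split => //; exact: E1A.
have [E EP] := choice sq.
have [th thI] := sphere_iso_exists S.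
have [et [thK etK thc etc]] := sphere_iso_homeo thI.
have [F _ cF] : finite_subset_cover setT (fun p : P1 R => th @^-1` E (th p)) setT.
  have := @one_point_compactification_compact C; rewrite compact_cover; apply.
    move=> p _; apply: open_comp; first by move=> ? _; exact: thc.
    by have [[]] := EP (th p).
  by move=> p _; exists p => //=; have [[]] := EP (th p).
pose V := [set ys : S * S | exists2 p, p \in F & E (th p) ys.1 /\ E (th p) ys.2].
have diagV (y : S) : nbhs (y, y) V.
  have [p pF /= pE] := cF (et y) I; rewrite etK in pE.
  exists (E (th p), E (th p)) => /=.
    by split; apply: open_nbhs_nbhs; have [[]] := EP (th p).
  by move=> ys []; exists p.
have FN : \forall n \near \oo, forall p, p \in F ->
    forall z s, E (th p) (psi n z) -> E (th p) s -> W (phi n z, s).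
  exact: (@filter_bigI _ _ F (fun p => [set n | forall z s,
    E (th p) (psi n z) -> E (th p) s -> W (phi n z, s)]) eventually _
    (fun p _ => (EP (th p)).2)).
move: (cvB V diagV); apply: filter_app; apply: filterS FN => n Fn Vn u Bu.
by have [p pF [/= E1 E2]] := Vn u Bu; exact: Fn E1 E2.
Qed.

End Charts.

(** * Replacing the charts of the target *)

Lemma dependent_family_choice (I : Type) (P : I -> Type)
    (Q : forall i, P i -> Prop) :
  (forall i, exists p, Q i p) -> exists f, forall i, Q i (f i).
Proof.
by move=> exQ; exists (fun i => projT1 (cid (exQ i))) => i; exact: projT2.
Qed.

Lemma existT_inj_tail (I : Type) (P : I -> Type) (i : I) (x y : P i) :
  existT P i x = existT P i y -> x = y.
Proof.
by move=> E; have := projT2_eq E; rewrite (Prop_irrelevance (projT1_eq E) erefl).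
Qed.

Section ChangeOfTarget.
Context {R : realType}.

Lemma same_iso_ex (S T : riemann_sphere R) (phi : nat -> P1 R -> S) : S = T ->
  exists psi : nat -> P1 R -> T, forall n, same_iso (phi n) (psi n).
Proof. by move=> ST; case: T / ST; exists phi. Qed.

(** The spheres are variables here because the equalities between them can be
    eliminated only then; points and charts of different trees become comparable
    once these equalities are gone. *)
Lemma same_iso_charts_asymptotic {U : finType} (X : {set U}) (A : U -> nat -> P1 R)
    (S S1 S2 : riemann_sphere R) (a : U -> S) (a1 : U -> S1) (a2 : U -> S2)
    (phi : nat -> P1 R -> S1) (chi psi : nat -> P1 R -> S2) :
  S = S1 -> S = S2 ->
  (forall x, x \in X -> same_point (a x) (a1 x) /\ same_point (a x) (a2 x)) ->
  (exists x1 x2 x3, [/\ x1 \in X, x2 \in X & x3 \in X] /\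
    [/\ a x1 <> a x2, a x2 <> a x3 & a x3 <> a x1]) ->
  (forall n, same_iso (phi n) (chi n)) ->
  (forall n, sphere_iso (phi n)) -> (forall n, sphere_iso (psi n)) ->
  (forall x, x \in X -> phi n (A x n) @[n --> \oo] --> a1 x) ->
  (forall x, x \in X -> psi n (A x n) @[n --> \oo] --> a2 x) ->
  (forall n, sphere_iso (chi n)) /\
  forall (y : S2) (V : set S2), nbhs y V -> exists2 B, nbhs y B &
    \forall n \near \oo, forall z, B (psi n z) -> V (chi n z).
Proof.
move=> E1; case: S1 / E1 a1 phi => a1 phi.
move=> E2; case: S2 / E2 a2 chi psi => a2 chi psi.
move=> aE [x1 [x2 [x3 [[X1 X2 X3] [n12 n23 n31]]]]] pc phiI psiI phic psic.
have {}pc n : phi n = chi n by exact: existT_inj_tail (pc n).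
have -> : chi = phi by apply/funext => n; rewrite pc.
have samept (y z : S) : same_point y z -> y = z by exact: existT_inj_tail.
have a1E x : x \in X -> a1 x = a x.
  by move=> /aE[/samept <- _].
have a2E x : x \in X -> a2 x = a x.
  by move=> /aE[_ /samept <-].
split=> // y V yV.
have phia x : x \in X -> phi n (A x n) @[n --> \oo] --> a x.
  by move=> xX; rewrite -(a1E _ xX); exact: phic.
have psia x : x \in X -> psi n (A x n) @[n --> \oo] --> a x.
  by move=> xX; rewrite -(a2E _ xX); exact: psic.
exact: (charts_asymptotic phiI psiI n12 n23 n31 (phia _ X1) (psia _ X1)
  (phia _ X2) (psia _ X2) (phia _ X3) (psia _ X3) yV).
Qed.

End ChangeOfTarget.

Theorem lemma4p8 (R : realType) (U : finType) (d : nat) (hd : (2 <= d)%N)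
  (Y Z : {set U}) (F : portrait Y Z d)
  (X : {set U}) (hXYZ : X \subset (Y :&: Z)%SET) (hX : (3 <= #|X|)%N)
  (f_ : nat -> marked_map R U) (hf : forall n, rat_system F X (f_ n))
  (G : tree_cover R Y Z) (TX : sphere_tree R X) (hG : dyn_system F G TX) :
  cvg_cover f_ G <-> dyn_cvg f_ G TX.
Proof.
split; last by move=> [phiY [phiZ [cv _]]]; exists phiY, phiZ.
move=> [phiY [phiZ cv]]; have [_ dyn] := hG.
have XY x : x \in X -> x \in Y.
  by move=> /(fintype.subsetP hXYZ); rewrite inE => /andP[].
have XZ x : x \in X -> x \in Z.
  by move=> /(fintype.subsetP hXYZ); rewrite inE => /andP[].
have /dependent_family_choice[chi chiP] : forall w,
    exists chi : nat -> P1 R -> sph (tgt G) w,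
    (internal TX w -> forall n, same_iso (phiY n w) (chi n)) /\
    (~~ internal TX w -> chi = phiZ^~ w).
  move=> w; have [iw|niw] := boolP (internal TX w); last by exists (phiZ^~ w).
  have [_ _ eY eZ _] := dyn w iw.
  have [chi chiP] := same_iso_ex (phiY^~ w) (etrans (esym eY) eZ).
  by exists chi.
exists phiY, (fun n w => chi w n); split; last first.
  by move=> n v iv; have [chiX _] := chiP v; exact: chiX.
move=> v iv w; have [isoYZ cvY cvZ cvf] := cv v iv.
have [iw|niw] := boolP (internal TX w); last first.
  by have [_ ->//] := chiP w.
have [chiX _] := chiP w.
have [iYw _ eY eZ pts] := dyn w iw.
have [isoYZw cvYw _ _] := cv w iYw.
(* the source and target marks of f_ n agree on X, so both sequences of charts
   are tested on the same points *)
have [isochi near_id] := same_iso_charts_asymptotic eY eZ pts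
  (three_distinct_marks iw) (chiX iw) (fun n => (isoYZw n).1)
  (fun n => (isoYZ n).2) (A := fun x n => mm_src (f_ n) x)
  (fun x xX => cvYw x (XY x xX))
  ltac:(move=> x xX; rewrite (_ : (fun n => _) =
          (fun n => phiZ n w (mm_tgt (f_ n) x))); [exact: cvZ (XZ x xX)|
        by apply/funext => n; have [_ _ _ _ ->] := hf n]).
split.
- by move=> n; split; [have [] := isoYZ n|exact: isochi].
- exact: cvY.
- move=> z zZ A /near_id[B zB BA].
  have : \forall n \near \oo, B (phiZ n w (mm_tgt (f_ n) z)) by exact: cvZ.
  by apply: filter_app; apply: filterS BA => n BAn; exact: BAn.
- exact: (charts_loc_unif (g := fun n => f_ n \o sphere_inv (phiY n v))
    near_id cvf).
Qed.
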